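(* Let $n$ be a positive integer and let $R$ be a nonzero ring. Then $MC_n(R)$ does not satisfy the descending chain condition on left direct summands, i.e. on left ideals that are direct summands of $MC_n(R)$ as a left module over itself.
   Context: All rings are associative with $1$. $M_m(R)$ is the ring of $m\times m$ matrices over $R$. Identify $M_n(M_{n^k}(R))$ with $M_{n^{k+1}}(R)$ via block matrices. The $n$-matricial closure $MC_n(R)$ is the direct limit of the rings $M_{n^k}(R)$, $k\in\mathbb{N}=\{0,1,2,\dots\}$ (with $M_{n^0}(R)=R$), along the injective ring morphisms $M_{n^k}(R)\to M_{n^{k+1}}(R)$ sending $A$ to the block diagonal matrix with $n$ diagonal blocks equal to $A$.
   Formalization: The formal theorem assumes n ≥ 2 instead of n a positive integer: for n = 1 the claim is false, since MC_1(R) = R and a field R has only the left ideals 0 and R, so it satisfies the descending chain condition. *)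

(* Defs.v *)
From HB Require Import structures.
From mathcomp Require Import all_boot all_order all_algebra.
From mathcomp Require Import boolp classical_sets.
Set Implicit Arguments.
Unset Strict Implicit.
Unset Printing Implicit Defensive.
Import GRing.Theory.
Local Open Scope classical_set_scope.
Local Open Scope ring_scope.
Local Open Scope quotient_scope.

Section DirectLimit.
Variables (A : nat -> pzRingType) (f : forall k, {rmorphism A k -> A k.+1}).

Notation stage := {k & A k}.

Definition step (x : stage) : stage := Tagged A (f _ (tagged x)).

(* The image in [A m] of an element [x] of stage [tag x <= m]; after
   [m - tag x] steps the tag is [m], so [tagged_as] is the identity cast.
   For [m < tag x] the value is junk. *)
Definition at_stage m (x : stage) : A m :=
  tagged_as (Tagged A (0 : A m)) (iter (m - tag x) step x).

Lemma tag_iter_step d x : tag (iter d step x) = (d + tag x)%N.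
Proof. by elim: d => //= d ->. Qed.

Lemma at_stageK m x : (tag x <= m)%N ->
  Tagged A (at_stage m x) = iter (m - tag x) step x.
Proof.
move=> le; rewrite /at_stage; have := tag_iter_step (m - tag x) x.
rewrite subnK //; case: (iter _ _ _) => k a /= e.
by case: _ / e; rewrite /= -[a]/(tagged (Tagged A a)) tagged_asE.
Qed.

Lemma eq_tagged m (a b : A m) : Tagged A a = Tagged A b -> a = b.
Proof. by move/eqP; rewrite eq_Tagged => /eqP. Qed.

Lemma at_stageT m (a : A m) : at_stage m (Tagged A a) = a.
Proof. by apply: eq_tagged; rewrite at_stageK //= subnn. Qed.

Lemma at_stageS m x : (tag x <= m)%N -> at_stage m.+1 x = f m (at_stage m x).
Proof.
move=> le; apply: eq_tagged; rewrite at_stageK ?leqW // subSn //=.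
by rewrite -at_stageK.
Qed.

Definition dl_eq (x y : stage) : bool :=
  `[< exists m, [/\ (tag x <= m)%N, (tag y <= m)%N &
        at_stage m x = at_stage m y] >].

Lemma at_stage_le m p x y : (tag x <= m)%N -> (tag y <= m)%N -> (m <= p)%N ->
  at_stage m x = at_stage m y -> at_stage p x = at_stage p y.
Proof.
move=> xm ym /subnK <- e; elim: (p - m)%N => [|d IH] //=.
by rewrite addSn !at_stageS ?IH // (leq_trans _ (leq_addl _ _)).
Qed.

Lemma dl_eq_refl : reflexive dl_eq.
Proof. by move=> x; apply/asboolP; exists (tag x). Qed.

Lemma dl_eq_sym : symmetric dl_eq.
Proof.
by move=> x y; apply/asboolP/asboolP => -[m [? ? e]]; exists m; split.
Qed.

Lemma dl_eq_trans : transitive dl_eq.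
Proof.
move=> y x z /asboolP[m [xm ym e]] /asboolP[p [yp zp e']]; apply/asboolP.
have mq := leq_maxl m p; have pq := leq_maxr m p.
exists (maxn m p); split; [exact: leq_trans mq|exact: leq_trans pq|].
by rewrite (at_stage_le xm ym mq e) (at_stage_le yp zp pq e').
Qed.

Canonical dl_equiv := EquivRel dl_eq dl_eq_refl dl_eq_sym dl_eq_trans.

Definition dirlim := {eq_quot dl_equiv}.
HB.instance Definition _ := Choice.on dirlim.
HB.instance Definition _ := EqQuotient.on dirlim.

Definition dl_in k (a : A k) : dirlim := \pi_dirlim (Tagged A a).

Lemma dl_in_eq k l (a : A k) (b : A l) :
  (dl_in a = dl_in b) <->
  exists m, [/\ (k <= m)%N, (l <= m)%N &
    at_stage m (Tagged A a) = at_stage m (Tagged A b)].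
Proof.
split=> [/eqP|h]; first by rewrite /dl_in eqmodE => /asboolP.
by apply/eqP; rewrite /dl_in eqmodE; apply/asboolP.
Qed.

Lemma dl_in_f k (a : A k) : dl_in (f k a) = dl_in a.
Proof.
apply/dl_in_eq; exists k.+1; split=> //.
by rewrite at_stageT (@at_stageS k (Tagged A a)) // at_stageT.
Qed.

Lemma dl_in_at m x : (tag x <= m)%N -> dl_in (at_stage m x) = \pi_dirlim x.
Proof.
case: x => k a; elim: m => [|m IH] /=.
  by case: k a => // a _; rewrite at_stageT.
rewrite leq_eqVlt => /predU1P[<-|lt]; first by rewrite at_stageT.
by rewrite at_stageS // dl_in_f IH.
Qed.

Lemma dl_repr m (u : dirlim) : exists k, (m <= k)%N /\ exists a : A k, u = dl_in a.
Proof.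
exists (maxn m (tag (repr u))); split; first exact: leq_maxl.
by exists (at_stage _ (repr u)); rewrite dl_in_at ?leq_maxr // reprK.
Qed.

Lemma at_stage_in m k (a : A k) : (k <= m)%N ->
  dl_in (at_stage m (Tagged A a)) = dl_in a.
Proof. by move=> le; rewrite dl_in_at. Qed.

Lemma dl_common3 (u v w : dirlim) :
  exists k (a b c : A k), [/\ u = dl_in a, v = dl_in b & w = dl_in c].
Proof.
have [k [_ [a ->]]] := dl_repr 0 u; have [l [kl [b ->]]] := dl_repr k v.
have [m [lm [c ->]]] := dl_repr l w.
exists m, (at_stage m (Tagged A a)), (at_stage m (Tagged A b)), c.
by rewrite !at_stage_in // (leq_trans kl).
Qed.

Definition dl_op2 (op : forall k, A k -> A k -> A k) (u v : dirlim) : dirlim :=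
  let m := maxn (tag (repr u)) (tag (repr v)) in
  dl_in (op m (at_stage m (repr u)) (at_stage m (repr v))).

Definition dl_add := dl_op2 (fun k => +%R).
Definition dl_mul := dl_op2 (fun k => *%R).
Definition dl_opp (u : dirlim) : dirlim := dl_in (- tagged (repr u)).
Definition dl_zero : dirlim := dl_in (0 : A 0).
Definition dl_one : dirlim := dl_in (1 : A 0).

Lemma dl_op2_in (op : forall k, A k -> A k -> A k) :
  (forall k, {morph f k : a b / op k a b >-> op k.+1 a b}) ->
  forall k (a b : A k), dl_op2 op (dl_in a) (dl_in b) = dl_in (op k a b).
Proof.
move=> fop k a b; rewrite /dl_op2; set x := repr _; set y := repr _.
pose opx p := op p (at_stage p x) (at_stage p y).
have opS d p : (tag x <= p)%N -> (tag y <= p)%N ->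
    dl_in (opx (d + p)%N) = dl_in (opx p).
  move=> xp yp; elim: d => // d <-; rewrite addSn -[RHS]dl_in_f fop /opx.
  by rewrite !at_stageS // ?(leq_trans xp) ?(leq_trans yp) // leq_addl.
have inS d : dl_in (op (d + k)%N (at_stage (d + k) (Tagged A a))
    (at_stage (d + k) (Tagged A b))) = dl_in (op k a b).
  elim: d => [|d <-]; first by rewrite !at_stageT.
  by rewrite addSn -[RHS]dl_in_f fop !at_stageS //= leq_addl.
have /asboolP[p [xp kp ep]] : dl_eq x (Tagged A a).
  by rewrite -[dl_eq _ _]/(dl_equiv _ _) -eqmodE reprK.
have /asboolP[q [yq kq eq]] : dl_eq y (Tagged A b).
  by rewrite -[dl_eq _ _]/(dl_equiv _ _) -eqmodE reprK.
have pr := leq_maxl p q; have qr := leq_maxr p q; set r := maxn p q in pr qr.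
rewrite -/(opx _) -(opS (r - maxn (tag x) (tag y))%N) ?leq_maxl ?leq_maxr //.
rewrite subnK; last by rewrite geq_max (leq_trans xp) ?(leq_trans yq).
rewrite /opx (at_stage_le xp kp pr ep) (at_stage_le yq kq qr eq).
by rewrite -(inS (r - k)%N) subnK // (leq_trans kp).
Qed.

Lemma dl_addE k (a b : A k) : dl_add (dl_in a) (dl_in b) = dl_in (a + b).
Proof. by apply: dl_op2_in => {}k {}a {}b /=; rewrite rmorphD. Qed.

Lemma dl_mulE k (a b : A k) : dl_mul (dl_in a) (dl_in b) = dl_in (a * b).
Proof. by apply: dl_op2_in => {}k {}a {}b /=; rewrite rmorphM. Qed.

Lemma dl_zeroE k : dl_zero = dl_in (0 : A k).
Proof. by elim: k => // k ->; rewrite -dl_in_f rmorph0. Qed.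

Lemma dl_oneE k : dl_one = dl_in (1 : A k).
Proof. by elim: k => // k ->; rewrite -dl_in_f rmorph1. Qed.

Fact dl_addA : associative dl_add.
Proof.
move=> u v w; have [k [a [b [c [-> -> ->]]]]] := dl_common3 u v w.
by rewrite !dl_addE addrA.
Qed.

Fact dl_addC : commutative dl_add.
Proof.
move=> u v; have [k [a [b [_ [-> -> _]]]]] := dl_common3 u v v.
by rewrite !dl_addE addrC.
Qed.

Fact dl_add0 : left_id dl_zero dl_add.
Proof.
move=> u; have [k [_ [a ->]]] := dl_repr 0 u.
by rewrite (dl_zeroE k) dl_addE add0r.
Qed.

Fact dl_addN : left_inverse dl_zero dl_opp dl_add.
Proof.
move=> u; rewrite -{2}[u]reprK /dl_opp; case: (repr u) => k a /=.
by rewrite -/(dl_in a) dl_addE addNr -dl_zeroE.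
Qed.

Fact dl_mulA : associative dl_mul.
Proof.
move=> u v w; have [k [a [b [c [-> -> ->]]]]] := dl_common3 u v w.
by rewrite !dl_mulE mulrA.
Qed.

Fact dl_mul1l : left_id dl_one dl_mul.
Proof.
move=> u; have [k [_ [a ->]]] := dl_repr 0 u.
by rewrite (dl_oneE k) dl_mulE mul1r.
Qed.

Fact dl_mul1r : right_id dl_one dl_mul.
Proof.
move=> u; have [k [_ [a ->]]] := dl_repr 0 u.
by rewrite (dl_oneE k) dl_mulE mulr1.
Qed.

Fact dl_mulDl : left_distributive dl_mul dl_add.
Proof.
move=> u v w; have [k [a [b [c [-> -> ->]]]]] := dl_common3 u v w.
by rewrite !(dl_addE, dl_mulE) mulrDl.
Qed.

Fact dl_mulDr : right_distributive dl_mul dl_add.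
Proof.
move=> u v w; have [k [a [b [c [-> -> ->]]]]] := dl_common3 u v w.
by rewrite !(dl_addE, dl_mulE) mulrDr.
Qed.

HB.instance Definition _ := GRing.isPzRing.Build dirlim
  dl_addA dl_addC dl_add0 dl_addN dl_mulA dl_mul1l dl_mul1r dl_mulDl dl_mulDr.

Fact dl_in_zmod_morphism k : zmod_morphism (@dl_in k).
Proof.
move=> a b; apply/eqP; rewrite eq_sym subr_eq; apply/eqP.
by rewrite -[RHS]/(dl_add _ _) dl_addE subrK.
Qed.

Fact dl_in_monoid_morphism k : monoid_morphism (@dl_in k).
Proof.
split=> [|a b]; first exact/esym/(dl_oneE k).
by rewrite -[RHS]/(dl_mul _ _) dl_mulE.
Qed.

HB.instance Definition _ k :=
  GRing.isZmodMorphism.Build (A k) dirlim (@dl_in k) (@dl_in_zmod_morphism k).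
HB.instance Definition _ k :=
  GRing.isMonoidMorphism.Build (A k) dirlim (@dl_in k)
    (@dl_in_monoid_morphism k).

End DirectLimit.

Section MatricialClosure.
Variables (n : nat) (R : pzRingType).

Fact block_dim k : (\sum_(i < n) n ^ k = n ^ k.+1)%N.
Proof. by rewrite sum_nat_const card_ord expnS. Qed.

Definition diag_blocks k (a : 'M[R]_(n ^ k)) : 'M[R]_(n ^ k.+1) :=
  castmx (block_dim k, block_dim k) (\mxdiag_(i < n) a).

Fact diag_blocks_zmod_morphism k : zmod_morphism (@diag_blocks k).
Proof.
move=> a b; rewrite /diag_blocks mxdiagB.
by case: _ / (block_dim k); rewrite !castmx_id.
Qed.

Fact diag_blocks_monoid_morphism k : monoid_morphism (@diag_blocks k).
Proof.
rewrite /diag_blocks; split=> [|a b].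
  by rewrite mxdiagZ; case: _ / (block_dim k); rewrite castmx_id.
case: _ / (block_dim k); rewrite !castmx_id [in RHS]/mxdiag.
rewrite -[RHS]/(_ *m _) mul_mxblock_mxdiag; apply: eq_mxblock => i j.
by case: (i == j); rewrite ?conform_mx_id ?mul0mx.
Qed.

HB.instance Definition _ k := GRing.isZmodMorphism.Build
  'M[R]_(n ^ k) 'M[R]_(n ^ k.+1) (@diag_blocks k) (@diag_blocks_zmod_morphism k).
HB.instance Definition _ k := GRing.isMonoidMorphism.Build
  'M[R]_(n ^ k) 'M[R]_(n ^ k.+1) (@diag_blocks k)
  (@diag_blocks_monoid_morphism k).

(* The first ring of the system, [R], appears as the 1 x 1 matrices
   ['M[R]_(n ^ 0)]. *)
Definition MC : Type :=
  dirlim (A := fun k => 'M[R]_(n ^ k)) (fun k => @diag_blocks k).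
HB.instance Definition _ := GRing.PzRing.on MC.

End MatricialClosure.

Section Modules.
Variables (S : pzRingType) (V : lmodType S).

Definition submodule (I : set V) : Prop := GRing.submod_closed [in I].

Definition direct_summand (I : set V) : Prop :=
  submodule I /\ exists J : set V,
    [/\ submodule J, [set x + y | x in I & y in J] = setT & I `&` J = [set 0]].

Definition dcc (P : set V -> Prop) : Prop :=
  forall I : nat -> set V, (forall k, P (I k)) ->
    (forall k, I k.+1 `<=` I k) ->
    exists m, forall k, (m <= k)%N -> I k = I m.

End Modules.

Definition dcc_left_summands (S : pzRingType) : Prop :=
  dcc (@direct_summand S S^o).

(* Main.v *)
(* The idempotents [e k], with a single 1 in the top left corner of the matrix
   ring of size [n ^ k], satisfy [e k * e k.+1 = e k.+1 = e k.+1 * e k] in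
   [MC n R], so the left ideals they generate form a descending chain of direct
   summands.  In stage [k.+1] the image of [e k] is block diagonal with [n]
   blocks [e k], while [e k.+1] keeps only the first block; as the stages embed
   in the limit and [1 < n], the chain is strict. *)
Require Import Defs.
From mathcomp Require Import all_boot all_order all_algebra.
From mathcomp Require Import boolp classical_sets.
Set Implicit Arguments.
Unset Strict Implicit.
Unset Printing Implicit Defensive.
Import GRing.Theory.
Local Open Scope ring_scope.

Section IdempotentSummands.
Variable S : pzRingType.

(** For idempotent [e] this set is the left ideal [S e], with membership stated as an equation. *)
Lemma submodule_fixr (e : S) :
  @submodule S S^o [set x : S | x * e = x]%classic.
Proof.
split=> [|a x y]; rewrite !inE /= ?mul0r // => xe ye.
by rewrite mulrDl -mulrA xe ye.
Qed.

(** The complement belongs to the idempotent [1 - e], through [x = x * e + x * (1 - e)]. *)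
Lemma direct_summand_idem (e : S) : e * e = e ->
  @direct_summand S S^o [set x : S | x * e = x]%classic.
Proof.
move=> ee; split; first exact: submodule_fixr.
exists [set x : S | x * (1 - e) = x]%classic; split.
- exact: submodule_fixr.
- apply/seteqP; split=> // x _; exists (x * e) => /=.
    by rewrite -mulrA ee.
  exists (x * (1 - e)) => /=; last by rewrite -mulrDr addrC subrK mulr1.
  by rewrite -mulrA mulrBr mulr1 mulrBl mul1r ee subrr subr0.
- apply/seteqP; split=> x /=; last by move=> ->; rewrite !mul0r.
  by case=> xe; rewrite mulrBr mulr1 xe subrr => <-.
Qed.

Lemma dcc_idem_stationary (e : nat -> S) : dcc_left_summands S ->
  (forall k, e k * e k = e k) ->
  (forall k, e k * e k.+1 = e k.+1) ->
  (forall k, e k.+1 * e k = e k.+1) ->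
  exists k, e k.+1 = e k.
Proof.
move=> dccS ee el er.
have [||m stable] := dccS (fun k => [set x : S | x * e k = x]%classic).
- by move=> k; apply: direct_summand_idem.
- by move=> k x /= <-; rewrite -mulrA er.
(* The goal becomes [e m * e m.+1 = e m]: membership of [e m] in the ideal of [e m.+1], which equals
   that of [e m]. *)
exists m; rewrite -el.
suff : [set x : S | x * e m.+1 = x]%classic (e m) by [].
by rewrite (stable m.+1 (leqnSn m)) /= ee.
Qed.

End IdempotentSummands.

(** Equality in the limit already holds at some stage [m]; injectivity of the transition maps brings
    it back down to [k]. *)
Lemma dl_in_inj (A : nat -> pzRingType)
    (f : forall k, {rmorphism A k -> A k.+1}) k :
  (forall k, injective (f k)) -> injective (@dl_in A f k).
Proof.
move=> f_inj a b /dl_in_eq[m [km _]].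
elim: m km => [|m IH]; rewrite leq_eqVlt => /predU1P[<-|//]; rewrite ?at_stageT //.
by rewrite ltnS => km; rewrite !at_stageS // => /f_inj; apply: IH.
Qed.

Lemma mul_mxdiag (R : pzRingType) p (p_ : 'I_p -> nat)
    (D E : forall i, 'M[R]_(p_ i)) :
  \mxdiag_i D i *m \mxdiag_i E i = \mxdiag_i (D i *m E i).
Proof.
rewrite [in LHS]/mxdiag mul_mxblock_mxdiag; apply: eq_mxblock => i j.
by case: eqP => [->|_]; rewrite ?conform_mx_id ?mul0mx.
Qed.

Section Corner.
Variables (n : nat) (R : pzRingType).

(** [diag_blocks a] is convertible to the case of a constant family, so the lemmas on [block_diag]
    apply to it too. *)
Definition block_diag k (D : 'I_n -> 'M[R]_(n ^ k)) : 'M[R]_(n ^ k.+1) :=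
  castmx (block_dim n k, block_dim n k) (\mxdiag_i D i).

Lemma block_diag_inj k (D E : 'I_n -> 'M[R]_(n ^ k)) :
  block_diag D = block_diag E -> D =1 E.
Proof.
rewrite /block_diag; case: _ / (block_dim n k).
by rewrite !castmx_id => /eq_mxdiagP.
Qed.

Lemma eq_block_diag k (D E : 'I_n -> 'M[R]_(n ^ k)) :
  D =1 E -> block_diag D = block_diag E.
Proof. by move=> DE; congr castmx; apply: eq_mxdiag. Qed.

Lemma mul_block_diag k (D E : 'I_n -> 'M[R]_(n ^ k)) :
  block_diag D * block_diag E = block_diag (fun i => D i * E i).
Proof.
rewrite /block_diag; case: _ / (block_dim n k).
by rewrite !castmx_id; apply: mul_mxdiag.
Qed.

Lemma diag_blocks_inj k : (0 < n)%N -> injective (@diag_blocks n R k).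
Proof. by move=> n_gt0 a b /block_diag_inj/(_ (Ordinal n_gt0)). Qed.

Fixpoint corner k : 'M[R]_(n ^ k) :=
  if k isn't k'.+1 then 1
  else block_diag (fun i => if i == 0%N :> nat then corner k' else 0).

Lemma corner_idem k : corner k * corner k = corner k.
Proof.
elim: k => [|k IH]; first exact: mulr1.
by rewrite mul_block_diag; apply: eq_block_diag => i; case: eqP; rewrite ?mul0r.
Qed.

Lemma diag_blocks_corner k : diag_blocks (corner k) * corner k.+1 = corner k.+1.
Proof.
rewrite [LHS]mul_block_diag; apply: eq_block_diag => i.
by case: eqP; rewrite ?mulr0 ?corner_idem.
Qed.

Lemma corner_diag_blocks k : corner k.+1 * diag_blocks (corner k) = corner k.+1.
Proof.
rewrite [LHS]mul_block_diag; apply: eq_block_diag => i.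
by case: eqP; rewrite ?mul0r ?corner_idem.
Qed.

End Corner.

Lemma corner_neq0 n (R : nzRingType) k : (0 < n)%N -> corner n R k != 0.
Proof.
move=> n_gt0; elim: k => [|k].
  by apply/eqP => /matrixP/(_ ord0 ord0)/eqP; rewrite !mxE oner_eq0.
(* Zero is written as [diag_blocks 0] so that first blocks can be compared. *)
apply: contra => /eqP; rewrite -(rmorph0 (@diag_blocks n R k)).
by move=> /block_diag_inj/(_ (Ordinal n_gt0)) corner0; apply/eqP.
Qed.

(** For [n = 1] the limit is [R] itself, which satisfies the chain condition when it is a field;
    hence [1 < n]. *)
Theorem proposition25 (n : nat) (R : nzRingType) (hn : (1 < n)%N) :
  ~ dcc_left_summands (MC n R).
Proof.
have n_gt0 : (0 < n)%N by apply: ltnW.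
pose incl k := @dl_in (fun k => 'M[R]_(n ^ k)) (fun k => @diag_blocks n R k) k.
have inclS k a : incl k a = incl k.+1 (diag_blocks a) by rewrite /incl dl_in_f.
move=> /(@dcc_idem_stationary (MC n R) (fun k => incl k (corner n R k))).
case=> [k|k|k|k] /=.
- by rewrite -rmorphM corner_idem.
- by rewrite (inclS k) -rmorphM diag_blocks_corner.
- by rewrite (inclS k) -rmorphM corner_diag_blocks.
rewrite (inclS k) => /dl_in_inj eq_corner.
have := eq_corner (fun k => @diag_blocks_inj n R k n_gt0).
(* The block of index 1 is [0] in [corner k.+1] but [corner k] in [diag_blocks (corner k)]. *)
move=> /block_diag_inj/(_ (Ordinal hn))/esym/eqP.
by rewrite (negPf (corner_neq0 R k n_gt0)).
Qed.
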